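(* For every total order $\prec$ on the set of variables $\{P_{ij} : 1\le i\le n+1,\ 1\le j\le n\}$, the size of every OBDD refutation of $\mathsf{PHP}_n$ with respect to $\prec$ is $\Omega(1.025^n)$.
   Context: The pigeonhole formula is the CNF $\mathsf{PHP}_n=\mathsf{PC}_n\wedge \mathsf{NC}_n$ over the propositional variables $P_{ij}$ ($1\le i\le n+1$, $1\le j\le n$), where $\mathsf{PC}_n=\bigwedge_{i=1}^{n+1}\big(\bigvee_{j=1}^{n}P_{ij}\big)$ and $\mathsf{NC}_n=\bigwedge_{1\le i<j\le n+1,\ 1\le k\le n}(\lnot P_{ik}\vee\lnot P_{jk})$. An OBDD (ordered binary decision diagram) for a total order $\prec$ on variables is a rooted directed acyclic graph with terminal nodes $0,1$ and decision nodes labelled by variables, each with a low and a high child, such that variables appear in $\prec$-increasing order along every path; all OBDDs are reduced (isomorphic subgraphs merged, nodes with isomorphic children removed), so each Boolean function has a unique OBDD $\mathsf{B}(\varphi,\prec)$. Its size is its number of internal (non-terminal) nodes. Given a total order $\prec$, an OBDD refutation of an unsatisfiable CNF $\varphi$ is a sequence of OBDDs $\mathsf{B}_1(\varphi_1,\prec),\dots,\mathsf{B}_l(\varphi_l,\prec)$ such that $\mathsf{B}_l$ represents the constant false and for each $i$ exactly one holds: (Axiom) $\mathsf{B}_i$ represents a clause $C$ of $\varphi$; (Join) there are $1\le i'<i''<i$ with $\varphi_i=\varphi_{i'}\wedge\varphi_{i''}$. The size of the refutation is $\sum_{i=1}^l \mathrm{size}(\mathsf{B}_i(\varphi_i,\prec))$.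 *)

(* Defs.v *)
From mathcomp Require Import all_boot.
Set Implicit Arguments.
Unset Strict Implicit.
Unset Printing Implicit Defensive.

Definition strict_total_order (V : finType) (prec : rel V) : Prop :=
  [/\ irreflexive prec, transitive prec &
      forall x y, x != y -> prec x y || prec y x].

(* [(x, true)] is the literal x and [(x, false)] its negation. *)
Definition literal (V : finType) := (V * bool)%type.
Definition clause (V : finType) := seq (literal V).
Definition cnf (V : finType) := seq (clause V).

Definition assignment (V : finType) := {ffun V -> bool}.

Definition literal_eval (V : finType) (a : assignment V) (l : literal V) : bool :=
  a l.1 == l.2.
Definition clause_eval (V : finType) (a : assignment V) (C : clause V) : bool :=
  has (literal_eval a) C.

(* Pigeons and holes are numbered from 0: the variable P_{ij} of the usual
   1-based presentation is the pair (i - 1, j - 1). *)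
Definition php_var (n : nat) : finType := ('I_n.+1 * 'I_n)%type.

Definition PC (n : nat) : cnf (php_var n) :=
  [seq [seq ((i, j), true) | j <- enum 'I_n] | i <- enum 'I_n.+1].

Definition NC (n : nat) : cnf (php_var n) :=
  [seq [:: ((t.1.1, t.2), false); ((t.1.2, t.2), false)]
     | t : 'I_n.+1 * 'I_n.+1 * 'I_n <- enum {: 'I_n.+1 * 'I_n.+1 * 'I_n} & t.1.1 < t.1.2].

Definition PHP (n : nat) : cnf (php_var n) := PC n ++ NC n.

(* [dnode] is the type of decision nodes only.  A vertex of the graph is
   either a terminal node [inl b] or a decision node [inr x]. *)
Record bdd (V : finType) := Bdd {
  dnode : finType;
  label : dnode -> V;
  low : dnode -> bool + dnode;
  high : dnode -> bool + dnode;
  root : bool + dnode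
}.

Section Bdd.
Variables (V : finType) (B : bdd V).

Definition vertex : finType := (bool + dnode B)%type.

Definition edge : rel vertex := fun u w =>
  if u is inr x then (w == low x) || (w == high x) else false.

Definition acyclic : Prop :=
  forall (u : vertex) (p : seq vertex),
    path edge u p -> last u p = u -> p = [::].

Definition rooted : Prop := forall x : dnode B, connect edge (root B) (inr x).

Definition vertex_label (u : vertex) : option V :=
  if u is inr x then Some (label x) else None.

Definition ordered (prec : rel V) : Prop :=
  forall (u : vertex) (p : seq vertex),
    path edge u p -> sorted prec (pmap vertex_label (u :: p)).

Definition subgraph (u : vertex) : {set vertex} := [set w | connect edge u w].

Definition isomorphic (u w : vertex) : Prop :=
  exists f : vertex -> vertex,
    [/\ f u = w,
        {in subgraph u &, injective f},
        f @: subgraph u = subgraph w,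
        forall b : bool, inl b \in subgraph u -> f (inl b) = inl b &
        forall x : dnode B, inr x \in subgraph u ->
          exists y : dnode B,
            [/\ f (inr x) = inr y, label y = label x,
                f (low x) = low y & f (high x) = high y]].

Definition reduced : Prop :=
  (forall u w : vertex, isomorphic u w -> u = w) /\
  (forall x : dnode B, ~ isomorphic (low x) (high x)).

Definition is_obdd (prec : rel V) : Prop :=
  [/\ acyclic, rooted, ordered prec & reduced].

Definition bdd_size : nat := #|dnode B|.

Definition bdd_step (a : assignment V) (u : vertex) : vertex :=
  if u is inr x then (if a (label x) then high x else low x) else u.

(* Terminals are fixed by [bdd_step]; in an acyclic graph #|dnode B| steps
   always suffice to reach one. *)
Definition bdd_eval (a : assignment V) : bool :=
  iter #|dnode B| (bdd_step a) (root B) == inl true.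

End Bdd.

Section Refutation.
Variables (V : finType) (prec : rel V) (phi : cnf V).
Variables (l : nat) (B : 'I_l.+1 -> bdd V).

Definition axiom_line (i : 'I_l.+1) : Prop :=
  exists2 C : clause V, C \in phi &
    forall a : assignment V, bdd_eval (B i) a = clause_eval a C.

(* Since reduced OBDDs are canonical, the formula attached to a line is
   identified with the Boolean function its OBDD computes. *)
Definition join_line (i : 'I_l.+1) : Prop :=
  exists i1 i2 : 'I_l.+1,
    i1 < i2 < i /\
    forall a : assignment V, bdd_eval (B i) a = bdd_eval (B i1) a && bdd_eval (B i2) a.

Definition obdd_refutation : Prop :=
  [/\ forall i, is_obdd (B i) prec,
      forall a : assignment V, bdd_eval (B ord_max) a = false &
      forall i, (axiom_line i \/ join_line i) /\ ~ (axiom_line i /\ join_line i)].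

Definition refutation_size : nat := \sum_(i < l.+1) bdd_size (B i).

End Refutation.

(* Main.v *)
Require Import Defs.
From mathcomp Require Import all_boot all_order all_algebra.
From mathcomp Require Import reals.
From mathcomp Require Import zify lra.
(** Cut the variable order after half of the variables, X being the prefix.
Counting shows that linearly many rows (pigeons), or linearly many columns
(holes), contain at least n/14 cells of X and n/14 cells of its complement; call
these rich.  Let mu count the pigeon clauses of rich rows (respectively the rich
columns with a hole clause joining a cell of X to one outside X) among the axioms
used by a line.  Axioms have mu <= 1, mu is subadditive under joins and large
for unsatisfiable clause sets, so some line has mu between t and 2t, where t is
about n/28.  For each of t rich rows (columns) counted by that line, one can
choose freely whether a pigeon is placed by the prefix or by the suffix while the
unused axioms leave room for a full placement; this gives a fooling set of size
2^t across the cut, hence an OBDD with about 2^t nodes, and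
1.025^28 <= 2. *)

Set Implicit Arguments.
Unset Strict Implicit.
Unset Printing Implicit Defensive.

(** * OBDDs cut at a prefix of the variable order; fooling sets *)

Section Cut.
Variables (V : finType) (prec : rel V) (X : {set V}) (B : bdd V).
Hypothesis acyclicB : acyclic B.
Hypothesis orderedB : ordered B prec.
Hypothesis Xdown : forall x y, prec x y -> y \in X -> x \in X.

Implicit Types (u : vertex B) (a : assignment V).

(** Termination measure: acyclicity makes it drop at each step out of a decision node, since that
    node is no longer reachable afterwards. *)
Definition rank u := #|[set y : dnode B | connect (@edge V B) u (inr y)]|.

Lemma edge_step a (x : dnode B) : edge (inr x) (bdd_step a (inr x)).
Proof. by rewrite /edge /bdd_step; case: ifP; rewrite eqxx ?orbT. Qed.

Lemma rank_step a (x : dnode B) : rank (bdd_step a (inr x)) < rank (inr x).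
Proof.
apply/proper_card/properP; split.
  apply/subsetP=> y; rewrite !inE; apply/connect_trans/connect1/edge_step.
exists x; rewrite !inE ?connect0 //.
apply/connectP=> -[p step_p last_p].
suff: bdd_step a (inr x) :: p = [::] by [].
by apply: (@acyclicB (inr x)) => //; apply/andP; split; first exact: edge_step.
Qed.

Definition stuck (Y : {set V}) u := if u is inr x then label x \notin Y else true.

(* The iterates freeze at the first terminal or vertex labelled outside Y. *)
Definition prefix_step (Y : {set V}) a u := if stuck Y u then u else bdd_step a u.

Lemma stuck_iter Y a u : stuck Y (iter #|dnode B| (prefix_step Y a) u).
Proof.
have: rank u <= #|dnode B| by apply: max_card.
elim: #|_| u => [|k IHk] u le_uk; rewrite ?iterSr /prefix_step.
  by case: u le_uk => // x; have := rank_step [ffun=> true] x; lia.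
case: ifP => [stuck_u|].
  by suff ->: iter k (prefix_step Y a) u = u by []; elim: k {IHk le_uk} => //= k ->;
     rewrite /prefix_step stuck_u.
case: u le_uk => // x le_xk _; apply: IHk.
by have := rank_step a x; lia.
Qed.

Lemma step_final a u :
  bdd_step a (iter #|dnode B| (bdd_step a) u) = iter #|dnode B| (bdd_step a) u.
Proof.
(* For [Y = setT] only terminals are stuck. *)
have := stuck_iter setT a u.
have /eq_iter->: prefix_step setT a =1 bdd_step a.
  by case=> // x; rewrite /prefix_step /= inE.
by case: (iter _ _ _) => // x; rewrite /= inE.
Qed.

Definition cut a := iter #|dnode B| (prefix_step X a) (Defs.root B).

Lemma eval_from_cut a :
  bdd_eval B a = (iter #|dnode B| (bdd_step a) (cut a) == inl true).
Proof.
rewrite /bdd_eval /cut; congr (_ == _).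
(* A prefix step is either idle or a genuine step, and the final vertex absorbs extra steps. *)
elim: {3}#|dnode B| => //= k ->; set u := iter k _ _.
by rewrite /prefix_step; case: ifP => // _; rewrite -iterSr iterS step_final.
Qed.

Lemma eq_cut a a' : {in X, a =1 a'} -> cut a = cut a'.
Proof.
move=> eq_a; apply: eq_iter => -[//|x]; rewrite /prefix_step /=.
by case: (boolP (label x \in X)) => //= /eq_a->.
Qed.

(** Labels increase along edges and [X] is downward closed, so a path that has left [X] never
    returns to it. *)
Lemma stuck_step a u : stuck X u -> stuck X (bdd_step a u).
Proof.
case: u => // x; have := edge_step a x; case: (bdd_step _ _) => // y xy /=.
apply: contra; apply: Xdown.
by have /= := @orderedB (inr x) [:: inr y]; rewrite !andbT; apply.
Qed.

Lemma eq_iter_step k a a' u : {in ~: X, a =1 a'} -> stuck X u ->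
  iter k (bdd_step a) u = iter k (bdd_step a') u.
Proof.
move=> eq_a; elim: k u => // k IHk u stuck_u; rewrite !iterSr.
have <-: bdd_step a u = bdd_step a' u.
  by case: u stuck_u => //= x Xx; rewrite eq_a // inE.
exact/IHk/stuck_step.
Qed.

Definition glue a b : assignment V := [ffun v => if v \in X then a v else b v].

Lemma eval_glue a b : cut a = cut b -> bdd_eval B (glue a b) = bdd_eval B b.
Proof.
move=> cut_ab; rewrite !eval_from_cut.
have ->: cut (glue a b) = cut b.
  by rewrite -cut_ab; apply: eq_cut => v Xv; rewrite ffunE Xv.
congr (_ == _); apply: eq_iter_step; last exact: stuck_iter.
by move=> v; rewrite inE ffunE => /negPf->.
Qed.

(** Two members with the same cut vertex could exchange prefixes, and both glued assignments would
    be accepted. So the cut vertices are distinct; the 2 counts the terminals. *)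
Lemma fooling_set_bound (I : finType) (F : {set I}) (c : I -> assignment V) :
    {in F, forall i, bdd_eval B (c i)} ->
    {in F &, forall i j, i != j ->
       ~~ (bdd_eval B (glue (c i) (c j)) && bdd_eval B (glue (c j) (c i)))} ->
  #|F| <= bdd_size B + 2.
Proof.
move=> Ftrue Ffalse.
have inj_cut: {in F &, injective (fun i => cut (c i))}.
  move=> i j Fi Fj cut_ij; apply: contraTeq isT => /(Ffalse i j Fi Fj).
  by rewrite !eval_glue // !Ftrue.
rewrite -(card_in_imset inj_cut) (leq_trans (max_card _)) //.
by rewrite /vertex card_sum card_bool addnC.
Qed.

End Cut.

(** * Prefixes of given size and lines of medium measure *)

Lemma down_set_exists (V : finType) (prec : rel V) k :
    irreflexive prec -> transitive prec -> k <= #|V| ->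
  exists2 X : {set V}, #|X| = k & forall x y, prec x y -> y \in X -> x \in X.
Proof.
move=> irr tr; elim: k => [|k IHk] lekV.
  by exists set0; rewrite ?cards0 // => x y _; rewrite inE.
have [X cardX downX] := IHk (ltnW lekV).
have /set0Pn[v0]: ~: X != set0 by rewrite -card_gt0 cardsCs setCK cardX subn_gt0.
rewrite inE => Xv0.
(* Fewest predecessors means minimal: a predecessor outside [X] would have strictly fewer. *)
case: (@arg_minnP _ v0 (fun v => v \notin X) (fun v => #|[set w | prec w v]|) Xv0).
move=> v Xv min_v; exists (v |: X); first by rewrite cardsU1 Xv cardX.
move=> x y xy; rewrite !inE => /orP[/eqP eq_y|/(downX _ _ xy)->]; last by rewrite orbT.
rewrite eq_y in xy; case: (boolP (x \in X)) => [|/min_v]; first by rewrite orbT.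
rewrite leqNgt proper_card //; apply/properP; split; last first.
  by exists x; rewrite !inE ?irr.
by apply/subsetP=> w; rewrite !inE => /tr; apply.
Qed.

(** [S] collects axioms used by a line. Joining two sets of measure below [t] stays below [2 * t],
    and the false last line cannot have measure below [t], so some line lands in between. *)
Lemma medium_line (V : finType) (prec : rel V) (phi : cnf V) l
    (B : 'I_l.+1 -> bdd V) (mu : cnf V -> nat) t :
    obdd_refutation prec phi B -> 1 < t ->
    (forall C, mu [:: C] <= 1) ->
    (forall S1 S2, mu (S1 ++ S2) <= mu S1 + mu S2) ->
    (forall S : cnf V, {subset S <= phi} -> mu S < t ->
       exists a, all (clause_eval a) S) ->
  exists i, exists S : cnf V,
    [/\ {subset S <= phi}, forall a, bdd_eval (B i) a = all (clause_eval a) S &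
        t <= mu S <= 2 * t].
Proof.
move=> [_ Bfalse lineB] t_gt1 mu1 muD mu_sat.
pose small (i : 'I_l.+1) (S : cnf V) :=
  [/\ {subset S <= phi}, forall a, bdd_eval (B i) a = all (clause_eval a) S & mu S < t].
pose medium := exists i, exists S : cnf V,
  [/\ {subset S <= phi}, forall a, bdd_eval (B i) a = all (clause_eval a) S &
      t <= mu S <= 2 * t].
suff small_or_medium m (i : 'I_l.+1) : i < m -> (exists S, small i S) \/ medium.
  have [[S [sS evalS /(mu_sat S sS)[a]]]|//] := small_or_medium _ _ (ltn_ord ord_max).
  by rewrite -evalS Bfalse.
elim: m i => // m IHm i ltim; have [[[C phiC evalC]|[i1 [i2 [/andP[lt12 lt2i] evali]]]] _] := lineB i.
  left; exists [:: C]; split=> [C'|a|]; first by rewrite inE => /eqP->.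
    by rewrite evalC /= andbT.
  by apply: leq_ltn_trans (mu1 C) t_gt1.
have [|[S1 [s1 eval1 mu_1]]|] := IHm i1; [lia| |by right].
have [|[S2 [s2 eval2 mu_2]]|] := IHm i2; [lia| |by right].
have sS: {subset S1 ++ S2 <= phi} by move=> C; rewrite mem_cat => /orP[/s1|/s2].
have evalS a: bdd_eval (B i) a = all (clause_eval a) (S1 ++ S2).
  by rewrite evali all_cat eval1 eval2.
have [lt_t|ge_t] := ltnP (mu (S1 ++ S2)) t.
  by left; exists (S1 ++ S2).
by right; exists i, (S1 ++ S2); split=> //; have := muD S1 S2; lia.
Qed.

(** * Distinct representatives *)

Lemma greedy_sdr (I H : finType) (F : I -> {set H}) (h0 : H) (s : seq I) :
    uniq s -> {in s, forall i, index i s < #|F i|} ->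
  exists2 r : I -> H, {in s &, injective r} & {in s, forall i, r i \in F i}.
Proof.
elim/last_ind: s => [|s i IHs]; first by exists (fun=> h0).
rewrite rcons_uniq => /andP[si us] szF.
have [j sj|r inj_r rF] := IHs us.
  by have := szF j; rewrite mem_rcons inE sj orbT -cats1 index_cat sj; apply.
(* Earlier elements take at most [size s] values, which is the index of [i], so [F i] still offers a
   free one. *)
have /set0Pn[h]: F i :\: [set r j | j in s] != set0.
  rewrite -card_gt0 cardsD subn_gt0.
  have := szF i; rewrite mem_rcons inE eqxx -cats1 index_cat (negPf si) /= eqxx addn0.
  move=> /(_ isT); apply: leq_ltn_trans.
  by rewrite (leq_trans (subset_leq_card (subsetIr _ _))) // (leq_trans (leq_imset_card _ _)) // card_size.
rewrite inE => /andP[Nrh Fh].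
have rs j: j \in s -> (if j == i then h else r j) = r j.
  by move=> sj; case: eqP => // eq_ji; rewrite -eq_ji sj in si.
have neq_h j: j \in s -> r j <> h.
  by move=> sj eq_h; case/imsetP: Nrh; exists j.
exists (fun j => if j == i then h else r j) => [j k|j]; rewrite ?mem_rcons ?inE; last first.
  by case/orP=> [/eqP->|sj]; rewrite ?eqxx // rs // rF.
case/orP=> [/eqP->|sj] /orP[/eqP->|sk]; rewrite ?eqxx ?rs //.
- by move/esym/neq_h=> /(_ sk).
- by move/neq_h=> /(_ sj).
exact: inj_r.
Qed.

(** Elements of [D] are served first, once on either side, each side offering [2 * #|D|] values;
    those of [E] take anything left. When the counts match, injectivity forces surjectivity. *)
Lemma pairing (K H : finType) (h0 : H) (X : K -> {set H}) (D E : {set K}) :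
    [disjoint D & E] ->
    {in D, forall k, 2 * #|D| <= #|X k| /\ 2 * #|D| <= #|~: X k|} ->
    2 * #|D| + #|E| <= #|H| ->
  exists r : K * bool -> H,
    [/\ {in D, forall k, r (k, true) \in X k /\ r (k, false) \notin X k},
        {in [pred p | (p.1 \in D) || (p.1 \in E) && p.2] &, injective r} &
        2 * #|D| + #|E| = #|H| ->
        forall h, exists2 p, (p.1 \in D) || (p.1 \in E) && p.2 & r p = h].
Proof.
move=> disDE degD szDE.
pose DD : {set K * bool} := setX D setT; pose EE : {set K * bool} := setX E [set true].
pose F p : {set H} := if p.1 \in D then (if p.2 then X p.1 else ~: X p.1) else setT.
have cardDD: #|DD| = 2 * #|D| by rewrite cardsX cardsT card_bool mulnC.
have cardEE: #|EE| = #|E| by rewrite cardsX cards1 muln1.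
have mem_s p : (p \in enum DD ++ enum EE) = (p.1 \in D) || (p.1 \in E) && p.2.
  by case: p => k b; rewrite mem_cat !mem_enum !inE andbT eqb_id.
have us: uniq (enum DD ++ enum EE).
  rewrite cat_uniq !enum_uniq andbT; apply/hasPn=> -[k b]; rewrite !mem_enum !inE /=.
  by case/andP=> Ek _; rewrite andbT (disjointFl disDE Ek).
have [p sp|r inj_r rF] := greedy_sdr (F := F) h0 us.
  rewrite index_cat !mem_enum; case: ifP => [DDp|].
    have ltp: index p (enum DD) < 2 * #|D| by rewrite -cardDD cardE index_mem mem_enum.
    have Dp: p.1 \in D by move: DDp; case: (p) => k b; rewrite !inE andbT.
    by apply: leq_trans ltp _; rewrite /F Dp; have [] := degD _ Dp; case: p.2.
  move=> /negbT DDp; have Dp: p.1 \notin D.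
    by move: DDp; case: (p) => k b; rewrite !inE andbT.
  have: index p (enum EE) < #|E|.
    rewrite -cardEE cardE index_mem; move: sp; rewrite mem_cat !mem_enum.
    by rewrite (negPf DDp).
  by rewrite -cardE cardDD /F (negPf Dp) cardsT => ltE; apply: leq_trans szDE; rewrite ltn_add2l.
exists r; split=> [k Dk|p q Jp Jq|szH h].
- have := rF (k, true); have := rF (k, false); rewrite !mem_s /F /= Dk inE => rf rt.
  by split; [apply: rt | apply: rf].
- by apply: inj_r; rewrite mem_s.
have: h \in [set r p | p in enum DD ++ enum EE].
  suff ->: [set r p | p in enum DD ++ enum EE] = setT by rewrite inE.
  apply/eqP; rewrite eqEcard subsetT cardsT card_in_imset // -szH.
  by rewrite (card_uniqP us) size_cat -!cardE cardDD cardEE leqnn.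
by case/imsetP=> p; rewrite mem_s => Jp ->; exists p.
Qed.

(** * Rich rows and columns of a half-full matrix *)

Lemma half_matrix_arith n t y a b a' b' r c h :
    999 < n -> 28 * t <= n + 28 -> h = 2 * t + 2 ->
    r <= 3 * t -> c <= 3 * t -> b <= a -> a' <= n ->
    n < r + b + a -> n <= c + b' + a' -> a * b' <= h * (a + b') ->
    y <= h * a' + (n - a') * n.+1 -> 2 * y <> n.+1 * n.
Proof.
move=> n_big t_small defh le_r le_c le_ba le_a'n rowsE colsE rect_le y_le eq_y.
(* Here [y] is the size of the complement of [X]; [a] and [a'] count its poor rows and columns, [b]
   and [b'] those of [X], [r] and [c] the rich ones. *)
have h_small: 13 * h <= n by lia.
have a_big: 4 * n <= 9 * a by lia.
have b'_small: 43 * b' <= 4 * n.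
  have : 43 * b' * a <= 4 * n * a.
    have : 52 * h * b' <= 9 * a * b' by rewrite leq_mul2r; apply/orP; right; lia.
    have : 13 * h * a <= n * a by rewrite leq_mul2r h_small orbT.
    by lia.
  by rewrite leq_mul2r; case/orP=> // /eqP a0; lia.
have d_small: 9 * (n - a') <= 2 * n by lia.
(* As 1/13 + 2/9 < 1/2, [y] falls short of half of the matrix. *)
have : y <= h * n + (n - a') * n.+1.
  by apply: leq_trans y_le _; rewrite leq_add2r leq_mul2l le_a'n orbT.
have : 9 * (n - a') * n.+1 <= 2 * n * n.+1 by rewrite leq_mul2r d_small orbT.
have : 13 * h * n <= n * n by rewrite leq_mul2r h_small orbT.
have : n * n >= n by rewrite leq_pmulr //; lia.
move: eq_y n_big; move: (n - a') => d; clear; lia.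
Qed.

Section Matrix.
Variables I J : finType.
Implicit Type X : {set I * J}.

Definition row X i : {set J} := [set j | (i, j) \in X].
Definition column X j : {set I} := [set i | (i, j) \in X].

Lemma rowC X i : row (~: X) i = ~: row X i.
Proof. by apply/setP=> j; rewrite !inE. Qed.

Lemma columnC X j : column (~: X) j = ~: column X j.
Proof. by apply/setP=> i; rewrite !inE. Qed.

Lemma card_rows X (A : {set I}) :
  #|X :&: setX A setT| = \sum_(i in A) #|row X i|.
Proof.
transitivity (\sum_(i in A) \sum_(j | (i, j) \in X) 1).
  rewrite pair_big_dep /= -sum1_card; apply: eq_bigl => -[i j].
  by rewrite !inE andbT andbC.
by apply: eq_bigr => i _; rewrite -sum1_card; apply: eq_bigl => j; rewrite inE.
Qed.

Lemma card_columns X (A : {set J}) :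
  #|X :&: setX setT A| = \sum_(j in A) #|column X j|.
Proof.
transitivity (\sum_(j in A) \sum_(i | (i, j) \in X) 1).
  rewrite (exchange_big_dep xpredT) //= pair_big_dep /= -sum1_card.
  by apply: eq_bigl => -[i j]; rewrite !inE andbC.
by apply: eq_bigr => j _; rewrite -sum1_card; apply: eq_bigl => i; rewrite inE.
Qed.

Definition poor_rows X h := [set i | #|row X i| < h].
Definition poor_columns X h := [set j | #|column X j| < h].

(** A cell of the rectangle lies in [X] and is charged to its poor column, or outside and is charged
    to its poor row. *)
Lemma card_poor_rect X h (a := #|poor_rows (~: X) h|) (b := #|poor_columns X h|) :
  a * b <= h * (a + b).
Proof.
set A := poor_rows _ _ in a *; set B := poor_columns _ _ in b *.
have -> : a * b = #|setX A B| by rewrite cardsX.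
have: #|(~: X) :&: setX A setT| <= h * a.
  rewrite card_rows mulnC -sum_nat_const; apply: leq_sum => i.
  by rewrite inE => /ltnW.
have: #|X :&: setX setT B| <= h * b.
  rewrite card_columns mulnC -sum_nat_const; apply: leq_sum => j.
  by rewrite inE => /ltnW.
suff: #|setX A B| <= #|X :&: setX setT B| + #|(~: X) :&: setX A setT| by nia.
rewrite (leq_trans _ (leq_card_setU _ _)) // subset_leq_card //.
by apply/subsetP=> -[i j]; rewrite !inE /= => /andP[-> ->]; rewrite !andbT orbN.
Qed.

Lemma card_le_poor_columns X h (a := #|poor_columns X h|) :
  #|X| <= h * a + (#|J| - a) * #|I|.
Proof.
set A := poor_columns _ _ in a *.
have eqX: X :&: setX setT setT = X by apply/setP=> -[i j]; rewrite !inE /= andbT.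
rewrite -{1}eqX card_columns (bigID (mem A)) /=; apply: leq_add.
  rewrite mulnC -sum_nat_const big_mkcondl /= big_mkcond [leqRHS]big_mkcond.
  by apply: leq_sum => j _; rewrite !inE /=; case: ifP => // /ltnW.
have ->: #|J| - a = #|~: A| by rewrite cardsCs setCK.
rewrite -sum_nat_const big_mkcond [leqRHS]big_mkcond.
by apply: leq_sum => j _; rewrite !inE /=; case: ifP => // _; apply: max_card.
Qed.

Definition rich_rows X h := [set i | h <= #|row X i| & h <= #|~: row X i|].
Definition rich_columns X h := [set j | h <= #|column X j| & h <= #|~: column X j|].

Lemma card_rich_rows X h :
  #|I| <= #|rich_rows X h| + #|poor_rows X h| + #|poor_rows (~: X) h|.
Proof.
rewrite -cardsT -addnA (leq_trans _ (leq_add (leqnn _) (leq_card_setU _ _))) //.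
rewrite (leq_trans _ (leq_card_setU _ _)) // subset_leq_card //.
by apply/subsetP=> i _; rewrite !inE rowC; do 2!case: leqP.
Qed.

Lemma card_rich_columns X h :
  #|J| <= #|rich_columns X h| + #|poor_columns X h| + #|poor_columns (~: X) h|.
Proof.
rewrite -cardsT -addnA (leq_trans _ (leq_add (leqnn _) (leq_card_setU _ _))) //.
rewrite (leq_trans _ (leq_card_setU _ _)) // subset_leq_card //.
by apply/subsetP=> i _; rewrite !inE columnC; do 2!case: leqP.
Qed.

(** Otherwise, up to complementing [X], at least 4/9 of [n] rows are poor outside [X]. By
    [card_poor_rect] few columns are then poor in [X], so most are poor outside [X], and the
    complement is too small. *)
Lemma half_matrix_rich X n t :
    #|I| = n.+1 -> #|J| = n -> 2 * #|X| = n.+1 * n -> 999 < n -> 28 * t <= n + 28 ->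
  3 * t < #|rich_rows X (2 * t + 2)| \/ 3 * t < #|rich_columns X (2 * t + 2)|.
Proof.
move=> szI szJ szX n_big t_small.
wlog le_poor : X szX / #|poor_rows X (2 * t + 2)| <= #|poor_rows (~: X) (2 * t + 2)|.
  move=> wlogX; have [|/ltnW le_poor] := leqP #|poor_rows X (2 * t + 2)| #|poor_rows (~: X) (2 * t + 2)|.
    exact: wlogX.
  have: 2 * #|~: X| = n.+1 * n.
    have := cardsC X; rewrite card_prod szI szJ; lia.
  move/wlogX; rewrite setCK => /(_ le_poor).
  have ->: rich_rows (~: X) (2 * t + 2) = rich_rows X (2 * t + 2).
    by apply/setP=> i; rewrite !inE rowC setCK andbC.
  have -> //: rich_columns (~: X) (2 * t + 2) = rich_columns X (2 * t + 2).
  by apply/setP=> j; rewrite !inE columnC setCK andbC.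
apply/orP; rewrite !ltnNge -negb_and; apply/negP=> /andP[].
have eq_Y: 2 * #|~: X| = n.+1 * n.
  have := cardsC X; rewrite card_prod szI szJ; lia.
move=> le_r le_c; have := card_le_poor_columns (~: X) (2 * t + 2).
have := card_rich_rows X (2 * t + 2); have := card_rich_columns X (2 * t + 2).
rewrite szI szJ => colsE rowsE y_le.
apply: (half_matrix_arith n_big t_small (erefl _) le_r le_c le_poor _ _ colsE _ y_le eq_Y).
- by rewrite -szJ max_card.
- by rewrite -ltnS in rowsE.
exact: card_poor_rect.
Qed.

End Matrix.

(** * Fooling assignments for sets of pigeonhole clauses *)

Section Pigeonhole.
Variable n : nat.
Implicit Types (a : assignment (php_var n)) (S : cnf (php_var n)).
Implicit Types (i j : 'I_n.+1) (k : 'I_n).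

Definition pigeon_clause i : clause (php_var n) := [seq ((i, k), true) | k <- enum 'I_n].
Definition hole_clause i j k : clause (php_var n) := [:: ((i, k), false); ((j, k), false)].

Lemma PHP_clauseP C : C \in PHP n ->
  (exists i, C = pigeon_clause i) \/ (exists i j k, i < j /\ C = hole_clause i j k).
Proof.
rewrite mem_cat => /orP[/mapP[i _ ->]|/mapP[[[i j] k]]]; first by left; exists i.
by rewrite mem_filter => /andP[lt_ij _] ->; right; exists i, j, k.
Qed.

Lemma eval_pigeon_clause a i : clause_eval a (pigeon_clause i) = [exists k, a (i, k)].
Proof.
apply/hasP/existsP=> [[_ /mapP[k _ ->] /eqP/= aik]|[k aik]]; first by exists k.
by exists ((i, k), true); [rewrite map_f ?mem_enum | rewrite /literal_eval /= aik].
Qed.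

Lemma eval_hole_clause a i j k :
  clause_eval a (hole_clause i j k) = ~~ (a (i, k) && a (j, k)).
Proof. by rewrite /clause_eval /= /literal_eval /=; case: (a _); case: (a _). Qed.

Lemma pigeon_clause_inj : 0 < n -> injective pigeon_clause.
Proof.
move=> n_gt0 i j eq_ij; have: ((i, Ordinal n_gt0), true) \in pigeon_clause j.
  by rewrite -eq_ij map_f ?mem_enum.
by case/mapP=> k _ [].
Qed.

Lemma all_clauseP S a : {subset S <= PHP n} ->
    (forall i, pigeon_clause i \in S -> exists k, a (i, k)) ->
    (forall i j k, i < j -> hole_clause i j k \in S -> ~~ (a (i, k) && a (j, k))) ->
  all (clause_eval a) S.
Proof.
move=> sS pigeons holes; apply/allP=> C SC.
have [[i eqC]|[i [j [k [ltij eqC]]]]] := PHP_clauseP (sS C SC); rewrite eqC in SC *.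
  by rewrite eval_pigeon_clause; apply/existsP/pigeons.
by rewrite eval_hole_clause holes.
Qed.

Variable X : {set php_var n}.

(* A pigeon i of A sits in a hole of X when i is in T, and otherwise in a hole
   outside X; gluing a prefix for T to a suffix for T' leaves T' :\: T homeless. *)
Lemma row_fooling S (A Q : {set 'I_n.+1}) :
    {subset S <= PHP n} -> A \subset Q -> (forall i, (pigeon_clause i \in S) = (i \in Q)) ->
    {in A, forall i, 2 * #|A| <= #|row X i| /\ 2 * #|A| <= #|~: row X i|} ->
    0 < n -> #|Q| + #|A| <= n ->
  exists c : {set 'I_n.+1} -> assignment (php_var n),
    (forall T, all (clause_eval (c T)) S) /\
    forall T T' : {set _}, T \subset A -> T' \subset A -> ~~ (T' \subset T) ->
      ~~ all (clause_eval (glue X (c T) (c T'))) S.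
Proof.
move=> sS sAQ SQ degA n_gt0 szQ.
have [||r [rA inj_r _]] := pairing (Ordinal n_gt0) (E := Q :\: A) _ degA.
- by rewrite disjoint_sym disjoints_subset subsetDr.
- by rewrite cardsDS // card_ord; have := subset_leq_card sAQ; lia.
(* For a pigeon of [A] the keys [true] and [false] give a hole inside and outside [X]; other pigeons
   of [Q] only have the key [true]. *)
pose hole (T : {set 'I_n.+1}) i := r (i, (i \notin A) || (i \in T)).
have holeJ (T : {set 'I_n.+1}) i : i \in Q ->
    (i, (i \notin A) || (i \in T)) \in [pred p | (p.1 \in A) || (p.1 \in Q :\: A) && p.2].
  by rewrite !inE /= => ->; case: (i \in A).
pose c (T : {set 'I_n.+1}) : assignment (php_var n) := [ffun v : php_var n => (v.1 \in Q) && (v.2 == hole T v.1)].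
exists c; split=> [T|T T' sT sT' /subsetPn[i T'i Ti]].
  apply: all_clauseP => // [i|i j k lt_ij _].
    by rewrite SQ => Qi; exists (hole T i); rewrite ffunE /= Qi eqxx.
  rewrite !ffunE /=; apply/negP=> /andP[/andP[Qi /eqP->] /andP[Qj /eqP eq_ij]].
  have [eq_i _] := inj_r _ _ (holeJ T i Qi) (holeJ T j Qj) eq_ij.
  by rewrite eq_i ltnn in lt_ij.
have Ai := subsetP sT' i T'i; have Qi := subsetP sAQ i Ai.
apply/allPn; exists (pigeon_clause i); first by rewrite SQ.
rewrite eval_pigeon_clause; apply/existsPn=> k; rewrite ffunE.
have [] := rA i Ai; rewrite !inE => rt rf.
case: ifPn => Xik; rewrite ffunE /= Qi /hole Ai /= ?T'i ?(negPf Ti) /=.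
  by apply: contra rf => /eqP<-.
by apply: contra Xik => /eqP->.
Qed.

(** Both orders are tested because [PHP n] contains [hole_clause i j k] only for [i < j], whichever
    pigeon is on the side of [X]. *)
Definition crossing S k :=
  [exists i, exists j, [&& (i, k) \in X, (j, k) \notin X &
     (hole_clause i j k \in S) || (hole_clause j i k \in S)]].

(* A hole of D has no crossing clause in S, so it can host two pigeons, one on each
   side of the cut; this compensates for the holes of A, which are kept free so
   that a crossing clause of S is violated when both sides use the hole. *)
Lemma column_fooling S (A D : {set 'I_n}) :
    {subset S <= PHP n} -> [disjoint A & D] -> #|D| = #|A|.+1 ->
    {in A, forall k, crossing S k} -> {in D, forall k, ~~ crossing S k} ->
    {in D, forall k, 2 * #|D| <= #|column X k| /\ 2 * #|D| <= #|~: column X k|} ->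
  exists c : {set 'I_n} -> assignment (php_var n),
    (forall T, all (clause_eval (c T)) S) /\
    forall T T' : {set _}, T \subset A -> T' \subset A -> ~~ (T \subset T') ->
      ~~ all (clause_eval (glue X (c T) (c T'))) S.
Proof.
move=> sS disAD szD crossA crossD degD.
have szAD : #|A :|: D| = #|A| + #|D| by rewrite cardsU disjoint_setI0 ?cards0 ?subn0.
(* Doubling the holes of [D] makes up for the holes of [A] and for the one missing hole; this is why
   [#|D|] is [#|A|.+1]. Hence [r] places every pigeon. *)
have szE : 2 * #|D| + #|~: (A :|: D)| = #|{: 'I_n.+1}|.
  have := cardsC (A :|: D); rewrite !card_ord szAD; lia.
have [||r [rD inj_r sur_r]] := pairing ord0 (E := ~: (A :|: D)) _ degD.
- by rewrite disjoints_subset setCK subsetUr.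
- by rewrite szE.
have {}sur_r := sur_r szE.
have [e eP] : exists e : 'I_n -> 'I_n.+1 * 'I_n.+1, forall k, k \in A ->
    [/\ ((e k).1, k) \in X, ((e k).2, k) \notin X &
    (hole_clause (e k).1 (e k).2 k \in S) || (hole_clause (e k).2 (e k).1 k \in S)].
  pose P k p := [&& (p.1, k) \in X, (p.2, k) \notin X &
     (hole_clause p.1 p.2 k \in S) || (hole_clause p.2 p.1 k \in S)].
  (* The default is never reached for [k] in [A]. *)
  exists (fun k => odflt (ord0, ord0) [pick p | P k p]) => k /crossA/existsP[i /existsP[j Pij]].
  by case: pickP => [p /and3P[]|/(_ (i, j))] //; rewrite /P Pij.
(* All pigeons already sit outside [A] through [r]. Each hole of [A] receives one extra pigeon, an
   endpoint of a crossing clause: the one in [X] if the hole is in [T], the other if not. *)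
pose c (T : {set 'I_n}) : assignment (php_var n) := [ffun v : php_var n =>
  if v.2 \in A then v.1 == (if v.2 \in T then (e v.2).1 else (e v.2).2)
  else (v.1 == r (v.2, true)) || (v.2 \in D) && (v.1 == r (v.2, false))].
exists c; split=> [T|T T' sT sT' /subsetPn[k Tk T'k]].
  apply: all_clauseP => // [i _|i j k lt_ij Sijk].
    have [[k b] /= Jk <-] := sur_r i; exists k; rewrite ffunE /=.
    have ->: (k \in A) = false.
      by case/orP: Jk => [/(disjointFl disAD)//|]; rewrite !inE negb_or -andbA => /andP[/negPf].
    by move: Jk; rewrite !inE; case: b; rewrite eqxx // andbF orbF => ->; rewrite orbT.
  rewrite !ffunE /=; case: ifP => [_|_].
    by apply: contraTN lt_ij => /andP[/eqP-> /eqP->]; rewrite ltnn.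
  case: (boolP (k \in D)) => Dk /=; last first.
    by rewrite !orbF; apply: contraTN lt_ij => /andP[/eqP-> /eqP->]; rewrite ltnn.
  have [] := rD k Dk; rewrite !inE => rt rf.
  apply: contra (crossD k Dk) => /andP[/orP[]/eqP eqi /orP[]/eqP eqj];
    try by rewrite eqi eqj ltnn in lt_ij.
    by apply/existsP; exists i; apply/existsP; exists j; rewrite eqi rt eqj rf -eqi -eqj Sijk.
  by apply/existsP; exists j; apply/existsP; exists i; rewrite eqj rt eqi rf -eqi -eqj Sijk orbT.
have Ak := subsetP sT k Tk; have [Xi Xj Sk] := eP k Ak.
apply/allPn; case/orP: Sk => Sk; [exists (hole_clause (e k).1 (e k).2 k) => //
                               | exists (hole_clause (e k).2 (e k).1 k) => //].
all: by rewrite eval_hole_clause !ffunE Xi (negPf Xj) /= Ak Tk (negPf T'k) !eqxx.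
Qed.


End Pigeonhole.

(** * A large line in every refutation *)

Lemma subset_of_card (T : finType) (A : {set T}) t :
  t <= #|A| -> exists2 A' : {set T}, A' \subset A & #|A'| = t.
Proof.
case/card_geqP=> s [us szs sA]; exists [set x in s].
  by apply/subsetP=> x; rewrite inE => /sA.
by rewrite cardsE (card_uniqP us).
Qed.

(** More than [t] elements of [R] avoid [Q]. With [Q] the pigeons whose clause is in [S], this is
    the room that [row_fooling] asks for. *)
Lemma card_add_small_inter (T : finType) (R Q : {set T}) n t :
  #|T| <= n.+1 -> 3 * t < #|R| -> #|R :&: Q| <= 2 * t -> #|Q| + t <= n.
Proof.
rewrite -cardsT -(cardsID Q setT) setTI -(cardsID Q R) => szT szR szRQ.
by have : #|R :\: Q| <= #|setT :\: Q| by [rewrite subset_leq_card // setSD ?subsetT]; lia.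
Qed.

Section LowerBound.
Variables (n : nat) (prec : rel (php_var n)) (X : {set php_var n}).
Variables (l : nat) (B : 'I_l.+1 -> bdd (php_var n)) (t : nat).
Hypothesis refB : obdd_refutation prec (PHP n) B.
Hypothesis Xdown : forall x y, prec x y -> y \in X -> x \in X.
Hypotheses (n_gt0 : 0 < n) (t_gt1 : 1 < t).

Lemma large_line i (I : finType) (S : cnf (php_var n)) (A : {set I})
    (c : {set I} -> assignment (php_var n)) :
    (forall a, bdd_eval (B i) a = all (clause_eval a) S) -> #|A| = t ->
    (forall T, all (clause_eval (c T)) S) ->
    (forall T T' : {set I}, T \subset A -> T' \subset A -> T != T' ->
      ~~ (all (clause_eval (glue X (c T) (c T'))) S &&
          all (clause_eval (glue X (c T') (c T))) S)) ->
  2 ^ t <= bdd_size (B i) + 2.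
Proof.
move=> evalB szA cT cTT'; have [/(_ i)[acB _ ordB _] _ _] := refB.
rewrite -szA -card_powerset; apply: (fooling_set_bound acB ordB Xdown (c := c)).
  by move=> T _; rewrite evalB.
by move=> T T'; rewrite !powersetE !evalB; apply: cTT'.
Qed.

Lemma large_line_rows :
    3 * t < #|rich_rows X (2 * t + 2)| -> exists i, 2 ^ t <= bdd_size (B i) + 2.
Proof.
set R := rich_rows _ _ => szR.
pose mu (S : cnf (php_var n)) := #|[set i in R | pigeon_clause i \in S]|.
have [C|S1 S2|S sS mu_lt|i [S [sS evalS /andP[ge_t le_t]]]] :=
    medium_line (mu := mu) refB t_gt1.
- apply/card_le1_eqP=> i j; rewrite !inE => /andP[_ /eqP eqi] /andP[_ /eqP eqj].
  by apply: (pigeon_clause_inj n_gt0); rewrite eqi eqj.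
- rewrite (leq_trans _ (leq_card_setU _ _)) // subset_leq_card //.
  by apply/subsetP=> i; rewrite !inE mem_cat andb_orr.
(* With [A] empty this yields just a satisfying assignment. Some pigeon clause is missing from [S],
   as otherwise [mu S] would be [#|R|]. *)
- have [] := @row_fooling n X S set0 [set i | pigeon_clause i \in S] sS.
  + exact: sub0set.
  + by move=> i; rewrite inE.
  + by move=> i; rewrite inE.
  + exact: n_gt0.
  + rewrite cards0 addn0 -ltnS.
    have: #|[set: 'I_n.+1]| <= n.+1 by rewrite cardsT card_ord.
    apply: leq_trans; rewrite proper_card // properT.
    apply: contraTneq mu_lt => SQ; rewrite -leqNgt /mu.
    suff ->: [set i in R | pigeon_clause i \in S] = R by lia.
    by apply/setP=> i; have := in_setT i; rewrite -SQ !inE => ->; rewrite andbT.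
  by move=> c [cS _]; exists (c set0).
have [A sA szA] := subset_of_card ge_t.
have [] := @row_fooling n X S A [set i | pigeon_clause i \in S] sS.
- by apply/subsetP=> j /(subsetP sA); rewrite !inE => /andP[].
- by move=> j; rewrite inE.
- move=> j /(subsetP sA); rewrite szA !inE => /andP[/andP[]] ? ? _; lia.
- exact: n_gt0.
- rewrite szA; apply: (card_add_small_inter (R := R)); rewrite ?card_ord //.
  by apply: leq_trans le_t; apply: subset_leq_card; apply/subsetP=> j; rewrite !inE.
move=> c [cS cTT']; exists i; apply: (large_line evalS szA cS) => T T' sT sT'.
rewrite eqEsubset negb_and negb_and => /orP[nsub|nsub]; apply/orP; [right|left].
all: exact: cTT'.
Qed.

Lemma large_line_columns :
    3 * t < #|rich_columns X (2 * t + 2)| -> exists i, 2 ^ t <= bdd_size (B i) + 2.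
Proof.
set R := rich_columns _ _ => szR.
pose mu (S : cnf (php_var n)) := #|[set k in R | crossing X S k]|.
have [C|S1 S2|S sS mu_lt|i [S [sS evalS /andP[ge_t le_t]]]] :=
    medium_line (mu := mu) refB t_gt1.
(* A hole clause determines its hole. *)
- apply/card_le1_eqP=> k k'; rewrite !inE => /andP[_ /existsP[i /existsP[j /and3P[_ _ eqk]]]].
  case/andP=> _ /existsP[i' /existsP[j' /and3P[_ _ eqk']]].
  move: eqk eqk'; rewrite !inE /hole_clause.
  by case/orP=> /eqP <- /orP[] /eqP[].
- rewrite (leq_trans _ (leq_card_setU _ _)) // subset_leq_card //.
  apply/subsetP=> k; rewrite !inE => /andP[-> /existsP[i /existsP[j /and3P[Xi Xj]]]] /=.
  rewrite !mem_cat -!orbA => Sij; apply/orP.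
  have [Sk|Sk] : (hole_clause i j k \in S1) || (hole_clause j i k \in S1) \/
                 (hole_clause i j k \in S2) || (hole_clause j i k \in S2).
  + by apply/orP; move: Sij; do 4!case: (_ \in _).
  + by left; apply/existsP; exists i; apply/existsP; exists j; rewrite Xi Xj.
  + by right; apply/existsP; exists i; apply/existsP; exists j; rewrite Xi Xj.
(* A single rich column that is not crossing serves as [D], with [A] empty. *)
- have /subsetPn[k Rk] : ~~ (R \subset [set k in R | crossing X S k]).
    by apply: contraTN mu_lt => /subset_leq_card; rewrite -leqNgt /mu; lia.
  rewrite inE Rk => /= crossk.
  have [] := @column_fooling n X S set0 [set k] sS.
  + by rewrite disjoints_subset sub0set.
  + by rewrite cards1 cards0.
  + by move=> k'; rewrite inE.
  + by move=> k'; rewrite inE => /eqP->.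
  + move=> k'; rewrite inE => /eqP->; rewrite cards1.
    by move: Rk; rewrite inE => /andP[] ? ?; lia.
  by move=> c [cS _]; exists (c set0).
have [A sA szA] := subset_of_card ge_t.
pose C := [set k | crossing X S k].
(* At most [2 * t] of the more than [3 * t] rich columns are crossing, which leaves the [t.+1]
   needed. *)
have [D sD szD] : exists2 D : {set 'I_n}, D \subset R :\: C & #|D| = t.+1.
  apply: subset_of_card; rewrite -(ltn_add2l #|R :&: C|) cardsID (leq_ltn_trans _ szR) //.
  rewrite (mulSn 2) addnC leq_add2l (leq_trans _ le_t) // subset_leq_card //.
  by apply/subsetP=> k; rewrite !inE.
have [] := @column_fooling n X S A D sS.
- rewrite disjoints_subset; apply/subsetP=> k /(subsetP sA); rewrite !inE => /andP[_ crossk].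
  by apply: contraTN crossk => /(subsetP sD); rewrite !inE => /andP[].
- by rewrite szA.
- by move=> k /(subsetP sA); rewrite inE => /andP[].
- by move=> k /(subsetP sD); rewrite !inE => /andP[].
- by move=> k /(subsetP sD); rewrite szD !inE => /andP[_ /andP[]] ? ?; lia.
move=> c [cS cTT']; exists i; apply: (large_line evalS szA cS) => T T' sT sT'.
rewrite eqEsubset negb_and negb_and => /orP[nsub|nsub]; apply/orP; [left|right].
all: exact: cTT'.
Qed.

End LowerBound.

Lemma large_line_exists n prec l (B : 'I_l.+1 -> bdd (php_var n)) t :
    strict_total_order prec -> obdd_refutation prec (PHP n) B ->
    999 < n -> 1 < t -> 28 * t <= n + 28 ->
  exists i, 2 ^ t <= bdd_size (B i) + 2.
Proof.
move=> [irr tr _] refB n_big t_gt1 t_small.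
have [X szX downX] : exists2 X : {set php_var n}, 2 * #|X| = n.+1 * n &
    forall x y, prec x y -> y \in X -> x \in X.
  (* The half is exact because [n.+1 * n] is even. *)
  have [|Y szY downY] := @down_set_exists _ prec (n.+1 * n)./2 irr tr.
    by rewrite card_prod !card_ord; lia.
  exists Y => //; rewrite szY mul2n even_halfK // oddM /=.
  by case: (odd n).
have n_gt0 : 0 < n by lia.
have [||rich|rich] := half_matrix_rich _ _ szX n_big t_small; rewrite ?card_ord //.
  exact: large_line_rows refB downX n_gt0 t_gt1 rich.
exact: large_line_columns refB downX n_gt0 t_gt1 rich.
Qed.

(** * The growth rate and the asymptotic bound *)

Import Order.TTheory GRing.Theory Num.Theory.
Local Open Scope ring_scope.

(** The margin is thin (the power is about 1.9965), so the exponents 3, 4, 7, 14, 28 are climbed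
    with tight rational upper bounds. *)
Lemma growth_le2 (R : realFieldType) : (1025 / 1000 : R) ^+ 28 <= 2.
Proof.
have powM (x y z : R) m k :
  0 <= x -> x ^+ m <= y -> x ^+ k <= z -> x ^+ (m + k) <= y * z.
  by move=> x_ge0 le_y le_z; rewrite exprD ler_pM ?exprn_ge0.
have -> : 1025 / 1000 = 41 / 40 :> R by lra.
set q : R := 41 / 40; have q_ge0 : 0 <= q by rewrite /q; lra.
have q3 : q ^+ 3 <= 1077 / 1000 by rewrite /q !exprS expr0; lra.
have q4 : q ^+ 4 <= 11039 / 10000 by rewrite /q !exprS expr0; lra.
have q7 : q ^+ 7 <= 1189 / 1000 by apply: le_trans (powM _ _ _ 3 4 q_ge0 q3 q4) _; lra.
have q14 : q ^+ 14 <= 1414 / 1000 by apply: le_trans (powM _ _ _ 7 7 q_ge0 q7 q7) _; lra.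
by apply: le_trans (powM _ _ _ 14 14 q_ge0 q14 q14) _; lra.
Qed.

Theorem theorem2 (R : realType) :
  exists c : R, 0 < c /\
  exists N : nat, forall n : nat, (N <= n)%N ->
  forall prec : rel (php_var n), strict_total_order prec ->
  forall (l : nat) (B : 'I_l.+1 -> bdd (php_var n)),
    obdd_refutation prec (PHP n) B ->
    c * (1025 / 1000) ^+ n <= (refutation_size B)%:R.
Proof.
(* The factor 1/2 absorbs the two terminals: [2 ^ t] is at least 4, so the size is at least 2 and
   [size + 2 <= 2 * size]. *)
exists 2^-1; split; first by rewrite invr_gt0 ltr0n.
exists 1000%N => n n_big prec ord_prec l B refB.
(* Large enough for [n <= 28 * t], small enough for [28 * t <= n + 28]. *)
pose t := (n %/ 28).+1.
have [i large_i] : exists i, (2 ^ t <= bdd_size (B i) + 2)%N.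
  by apply: (large_line_exists ord_prec refB); rewrite /t; lia.
have pow_t : (1025 / 1000 : R) ^+ n <= 2 ^+ t.
  have le_t : (n <= 28 * t)%N by rewrite /t; lia.
  apply: le_trans (_ : (1025 / 1000 : R) ^+ (28 * t) <= _).
    by rewrite ler_weXn2l //; lra.
  by rewrite exprM lerXn2r ?nnegrE ?exprn_ge0 ?growth_le2 //; lra.
have pow_size : 2 ^+ t <= ((2 * refutation_size B)%N%:R : R).
  rewrite -natrX ler_nat.
  have : (bdd_size (B i) <= refutation_size B)%N by rewrite /refutation_size (bigD1 i) //= leq_addr.
  have : (2 ^ 2 <= 2 ^ t)%N by rewrite leq_exp2l // /t; lia.
  by lia.
have {pow_t pow_size} := le_trans pow_t pow_size.
by rewrite natrM; lra.
Qed.
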